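(* Let $n,k$ be positive integers with $k<\frac n2$, and let $a\leq n$ be a positive integer greater than $2$. If $\mathcal{F}$ is an $(n,k)$-wreath, then $$y_{a,\mathcal{F}}=\sum_{\sigma\in S_a}\operatorname{sgn}(\sigma)\,e_{\sigma\mathcal{F}}$$ is in the kernel of the $(n,k)$-wreath matrix $M$.
   Context: $\mathbb{Z}_n$ is the set of integers modulo $n$, $\mathbb{Z}_n^{(k)}$ is the set of its $k$-element subsets, and $S_n$ is the group of permutations of $\mathbb{Z}_n$. For $a\le n$, $S_a$ is viewed as the subgroup of $S_n$ of permutations fixing every element outside $\{1,\dots,a\}\subseteq\mathbb{Z}_n$. For $\pi\in S_n$, let $\mathcal{F}_\pi=\{\{\pi((i-1)k+1),\ldots,\pi(ik)\} : i\in\mathbb{Z}_n\}\subset\mathbb{Z}_n^{(k)}$ (arguments modulo $n$). An $(n,k)$-wreath is a family of the form $\mathcal{F}_\pi$; $\mathcal{W}_{n,k}$ is the set of all of them. $S_n$ acts on $\mathcal{W}_{n,k}$ by $\tau\mathcal{F}_\pi=\mathcal{F}_{\tau\pi}$ (equivalently, by applying $\tau$ to every set of the wreath). The $(n,k)$-wreath matrix $M$ has rows and columns labelled by $\mathcal{W}_{n,k}$ and entries $M_{\mathcal{F},\mathcal{F}'}=|\mathcal{F}\cap\mathcal{F}'|$. It acts on the complex vector space $V$ with basis $\{e_{\mathcal{F}}:\mathcal{F}\in\mathcal{W}_{n,k}\}$. *)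

(* Defs.v *)
From HB Require Import structures.
From mathcomp Require Import all_boot all_order all_fingroup all_algebra.
From mathcomp Require Import reals.
From mathcomp Require Import complex.
Set Implicit Arguments.
Unset Strict Implicit.
Unset Printing Implicit Defensive.
Import GRing.Theory.
Local Open Scope ring_scope.

(* 'Z_n is the ring of integers modulo n only when 1 < n; this holds whenever
   0 < k and 2 * k < n.  All arithmetic on positions below is modulo n. *)

Section Wreaths.
Variables n k : nat.

(* {pi((i-1)k+1), ..., pi(ik)}; the index j ranges over 0, ..., k-1. *)
Definition wreath_block (p : {perm 'Z_n}) (i : 'Z_n) : {set 'Z_n} :=
  [set p ((i - 1) * k%:R + j.+1%:R) | j : 'I_k].

Definition wreath_of (p : {perm 'Z_n}) : {set {set 'Z_n}} :=
  [set wreath_block p i | i : 'Z_n].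

Definition wreaths : {set {set {set 'Z_n}}} :=
  [set wreath_of p | p : {perm 'Z_n}].

Definition wreath : finType := {F : {set {set 'Z_n}} | F \in wreaths}.

Definition act_family (t : {perm 'Z_n}) (F : {set {set 'Z_n}}) :
  {set {set 'Z_n}} := [set t @: A | A : {set 'Z_n} in F].

(* In MathComp (p * t) x = t (p x), so p * t is the composite "t after p". *)
Lemma act_wreath_of (t p : {perm 'Z_n}) :
  act_family t (wreath_of p) = wreath_of (p * t)%g.
Proof.
rewrite /act_family /wreath_of -imset_comp; apply: eq_imset => i /=.
by rewrite /wreath_block -imset_comp; apply: eq_imset => j /=; rewrite permM.
Qed.

Lemma act_family_wreaths (t : {perm 'Z_n}) (F : {set {set 'Z_n}}) :
  F \in wreaths -> act_family t F \in wreaths.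
Proof. by case/imsetP=> p _ ->; rewrite act_wreath_of imset_f. Qed.

Definition wreath_act (t : {perm 'Z_n}) (F : wreath) : wreath :=
  exist _ (act_family t (val F)) (act_family_wreaths t (valP F)).

(* The permutations fixing every element outside {1, ..., a}. *)
Definition S_sub (a : nat) : {set {perm 'Z_n}} :=
  Sym [set (i.+1%:R : 'Z_n) | i : 'I_a].

Section WreathMatrix.
Variable C : nzRingType.

(* Rows and columns are labelled by wreaths through enum_val / enum_rank. *)
Definition wreath_matrix : 'M[C]_#|wreath| :=
  \matrix_(i, j) #|val (enum_val i) :&: val (enum_val j)|%:R.

Definition wreath_basis (F : wreath) : 'cV[C]_#|wreath| :=
  delta_mx (enum_rank F) 0.

Definition wreath_altsum (a : nat) (F : wreath) : 'cV[C]_#|wreath| :=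
  \sum_(s in S_sub a) (-1) ^+ s *: wreath_basis (wreath_act s F).

End WreathMatrix.
End Wreaths.

Arguments wreath_matrix n k C : clear implicits.
Arguments wreath_altsum {n k} C a F.

(* Main.v *)
Require Import Defs.
From mathcomp Require Import all_boot all_order all_fingroup all_algebra.
From mathcomp Require Import reals.
From mathcomp Require Import complex.
Import GRing.Theory.
Local Open Scope ring_scope.

(** Row [G] of the product is the alternating sum over [s] in [Sym X] of
    [|G :&: s F|], where [X] is the set of residues [1, ..., a].  Since [s] acts
    injectively on subsets, this intersection is counted by the sets [A] of [F]
    with [s @: A] in [G], so exchanging the two sums leaves, for each single
    set [A], the alternating sum of the indicator of [s @: A] in [G].

    A set [A] splits [X] into two parts.  Since [X] has at least three elements,
    two of them, [x] and [y], lie in the same part, and then the transposition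
    of [x] and [y] maps [A] to itself.  Composing with it pairs the even
    permutations with the odd ones without changing [s @: A], so the sum
    vanishes already for each [A] ([altsum_image_eq0]). *)

(** Precomposition with [tperm x y] is a bijection between the even and the odd
    elements of [Sym X].  Cancelling these two halves, rather than deducing that
    the sum equals its opposite, makes this hold in every characteristic. *)
Lemma altsum_tperm_eq0 (C : nzRingType) (T : finType) (X : {set T})
    (f : {perm T} -> C) (x y : T) :
  x \in X -> y \in X -> x != y ->
  (forall s, f (tperm x y * s)%g = f s) ->
  \sum_(s in Sym X) (-1) ^+ odd_perm s * f s = 0.
Proof.
move=> xX yX nxy ft.
have tX : tperm x y \in Sym X.
  rewrite inE; apply/subsetP=> z; apply: contraR => zX.
  by rewrite tpermD //; apply: contraNneq zX => <-.
rewrite (bigID (fun s : {perm T} => odd_perm s)) /=.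
rewrite (reindex_inj (mulgI (tperm x y))) /=.
rewrite (eq_bigl (fun s => (s \in Sym X) && ~~ odd_perm s)); last first.
  by move=> s; rewrite groupMl // odd_permM odd_tperm nxy addTb.
rewrite -big_split /= big1 // => s /andP[_ /negbTE even_s].
by rewrite odd_permM odd_tperm nxy even_s ft !mul1r expr1 mulN1r addNr.
Qed.

Lemma tperm_imset_id (T : finType) (A : {set T}) (x y : T) :
  (x \in A) = (y \in A) -> tperm x y @: A = A.
Proof.
move=> Axy; apply/setP=> z.
rewrite -{1}[z](tpermK x y) mem_imset; last exact: perm_inj.
by case: tpermP => [->|->|].
Qed.

Lemma pigeonhole_same_side (T : finType) (X A : {set T}) :
  (2 < #|X|)%N ->
  exists x y, [/\ x \in X, y \in X, x != y & (x \in A) = (y \in A)].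
Proof.
move=> X3.
have /dinjectivePn[x xX [y /andP[nyx yX] Axy]] :
    ~~ dinjectiveb (fun z => z \in A) (mem X).
  apply/negP=> /dinjectiveP/card_in_imset cX.
  by move: X3; rewrite -cX ltnNge -card_bool max_card.
by exists x, y; split; rewrite // eq_sym.
Qed.

(** Three points of [X] cannot be separated by [A] and its complement, so some
    transposition in [Sym X] stabilises [A]; it is this odd stabiliser element
    that forces the cancellation.  The weight [f] is arbitrary so that it can be
    taken to be the indicator of any family of sets. *)
Lemma altsum_image_eq0 (C : nzRingType) (T : finType) (X A : {set T})
    (f : {set T} -> C) :
  (2 < #|X|)%N -> \sum_(s in Sym X) (-1) ^+ odd_perm s * f (s @: A) = 0.
Proof.
move=> /(@pigeonhole_same_side _ _ A)[x [y [xX yX nxy Axy]]].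
apply: (@altsum_tperm_eq0 C T X (fun s => f (s @: A)) x y) => // s.
rewrite -{2}(tperm_imset_id _ _ _ _ Axy) -imset_comp.
by congr f; apply: eq_imset => z; rewrite permM.
Qed.

Lemma natr_card_setI_act (C : nzRingType) (n : nat) (G F : {set {set 'Z_n}})
    (s : {perm 'Z_n}) :
  #|G :&: act_family s F|%:R = \sum_(A in F) (s @: A \in G)%:R :> C.
Proof.
rewrite -sum1_card natr_sum big_mkcond /=.
rewrite [LHS](eq_bigr (fun B => if B \in act_family s F
                               then (B \in G)%:R else 0)); last first.
  by move=> B _; rewrite inE andbC; case: (B \in act_family s F); case: (B \in G).
rewrite -big_mkcond /= big_imset //=.
by apply: in2W; apply: imset_inj; apply: perm_inj.
Qed.

Lemma card_first_residues (n a : nat) :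
  (1 < n)%N -> (a <= n)%N -> #|[set (i.+1%:R : 'Z_n) | i : 'I_a]| = a.
Proof.
move=> n1 an; rewrite card_imset ?card_ord // => i j /(congr1 val) /=.
rewrite !val_Zp_nat // => /eqP.
rewrite -[i.+1]addn1 -[j.+1]addn1 eqn_modDr !modn_small ?(leq_trans (ltn_ord _) an) //.
by move=> /eqP/val_inj.
Qed.

Theorem corollary5p4 (R : realType) (n k a : nat)
    (hn : (0 < n)%N) (hk : (0 < k)%N) (hkn : (2 * k < n)%N)
    (ha : (2 < a)%N) (han : (a <= n)%N) (F : wreath n k) :
  wreath_matrix n k (complex R) *m wreath_altsum (complex R) a F = 0.
Proof.
have n1 : (1 < n)%N by apply: leq_trans han; apply: ltnW.
apply/matrixP=> i j; rewrite ord1 /wreath_altsum mulmx_sumr summxE mxE.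
under eq_bigr => s _.
  rewrite -scalemxAr -colE !mxE enum_rankK natr_card_setI_act mulr_sumr; over.
rewrite exchange_big big1 //= => A _.
apply: (@altsum_image_eq0 _ _ _ A (fun B => (B \in val (enum_val i))%:R)).
by rewrite card_first_residues.
Qed.
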